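(* There exist constants $c>0$ and $n_0$ such that for all integers $n\geqslant n_0$ and all integers $k$ with $0\leqslant k<n$, $$\delta_C(n,k) \geqslant c\,\frac{n}{(k+1)\log n}.$$ (That is, $\delta_C(n,k)=\Omega\big(n/((k+1)\log n)\big)$.)
   Context: For a graph $G$ whose vertices are points in the plane, each edge $(u,v)$ has weight equal to the Euclidean distance $d(u,v)$ (edges may cross or overlap), and $d_G(u,v)$ is the length of a shortest path in $G$ between $u$ and $v$. The dilation of $G$ is $\Delta(G)=\max_{u\neq v\in V(G)} d_G(u,v)/d(u,v)$ (infinite if $G$ is disconnected). For a finite set $S$ of $n$ points and an integer $k\ge0$, $\Delta(S,k)$ is the minimum of $\Delta(G)$ over all graphs $G$ with vertex set exactly $S$ and exactly $n-1+k$ edges. $\delta_C(n,k)$ is the supremum of $\Delta(S,k)$ over all sets $S$ of $n$ points in $\mathbb{R}^2$ in convex position (all points lie on the boundary of their convex hull). *)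

(* Defs.v *)
From HB Require Import structures.
From mathcomp Require Import all_boot all_order all_algebra.
From mathcomp Require Import all_classical all_reals all_analysis.
From mathcomp Require Import Rstruct.
Set Implicit Arguments. Unset Strict Implicit. Unset Printing Implicit Defensive.
Import Order.TTheory GRing.Theory Num.Theory.
Local Open Scope ring_scope.
Local Open Scope classical_set_scope.

Definition R := Rdefinitions.R.
Definition point := (R * R)%type.

Definition dist (p q : point) : R :=
  Num.sqrt ((p.1 - q.1) ^+ 2 + (p.2 - q.2) ^+ 2).

Definition point_set (n : nat) (S : 'I_n -> point) : Prop := injective S.

Definition in_hull (n : nat) (S : 'I_n -> point) (q : point) : Prop :=
  exists w : 'I_n -> R, (forall i, 0 <= w i) /\ \sum_i w i = 1 /\
    q = (\sum_i w i * (S i).1, \sum_i w i * (S i).2).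

(* Convex position: every point lies on the boundary of the convex hull,
   i.e. no point of S lies in the interior of conv(S). *)
Definition convex_position (n : nat) (S : 'I_n -> point) : Prop :=
  forall i : 'I_n, ~ (exists e : R, 0 < e /\
     forall q : point, dist q (S i) < e -> in_hull S q).

Definition graph_ok (n : nat) (E : {set 'I_n * 'I_n}) : Prop :=
  forall e, e \in E -> (e.1 < e.2)%N.

Definition adj (n : nat) (E : {set 'I_n * 'I_n}) (x y : 'I_n) : bool :=
  ((x, y) \in E) || ((y, x) \in E).

Definition walk_len (n : nat) (S : 'I_n -> point) (u : 'I_n) (p : seq 'I_n) : R :=
  \sum_(d <- pairmap (fun a b => dist (S a) (S b)) u p) d.

(* shortest-path distance d_G(u,v) (+oo if no path) *)
Definition dG (n : nat) (S : 'I_n -> point) (E : {set 'I_n * 'I_n}) (u v : 'I_n)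
  : \bar R :=
  ereal_inf [set (walk_len S u p)%:E | p in
     [set p : seq 'I_n | path (adj E) u p /\ last u p = v]].

Definition dilation (n : nat) (S : 'I_n -> point) (E : {set 'I_n * 'I_n}) : \bar R :=
  ereal_sup [set (dG S E uv.1 uv.2 * ((dist (S uv.1) (S uv.2))^-1)%:E)%E |
               uv in [set uv : 'I_n * 'I_n | uv.1 <> uv.2]].

Definition Delta (n : nat) (S : 'I_n -> point) (k : nat) : \bar R :=
  ereal_inf [set dilation S E | E in
     [set E : {set 'I_n * 'I_n} | graph_ok E /\ #|E| = (n - 1 + k)%N]].

Definition delta_C (n k : nat) : \bar R :=
  ereal_sup [set Delta S k | S in
     [set S : 'I_n -> point | point_set S /\ convex_position S]].

(* Main.v *)
(* Put the points on two vertical lines at distance M ~ 4 t, at equal heights,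
   with 2k+4 special heights ("cuts") such that the gap at distance h from the
   nearest cut is about 1 + h / M and consecutive cuts are at least M^2 / 4
   apart. The gaps grow geometrically, so a block between two cuts needs
   O(t log t) points, for a total of O((k+1) t log t).

   Suppose the dilation is less than t. The path joining two vertically
   consecutive points then either is too short to change line or does not meet
   any cut, and the path joining the two points of a cut does not reach another
   cut. So over F_2 each cut, seen as the set of edges of the left line that
   cross it, is detected by cycles through neighbouring cuts, and at least half
   of the cuts (minus the two extreme ones) are independent modulo coboundaries.
   This gives k+1 independent cycles, too many for n-1+k edges. *)
Require Import Defs.
From HB Require Import structures.
From mathcomp Require Import all_boot all_order all_algebra.
From mathcomp Require Import all_classical all_reals all_analysis.
From mathcomp Require Import Rstruct.
From mathcomp Require Import zify ring lra.
Import Order.TTheory GRing.Theory Num.Theory.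
Set Implicit Arguments.
Unset Strict Implicit.
Unset Printing Implicit Defensive.

(** * Heights of the ladder and sizes of its gaps *)

(* Heights grow away from a cut with gaps 1 + distance / M, hence double every
   M steps; a block is 2 * D gaps, symmetric about its middle, and the cuts are
   the block boundaries j * D.*2. *)
Fixpoint offset (M a : nat) : nat :=
  if a is b.+1 then offset M b + 1 + offset M b %/ M else 0.

Definition height (M D i : nat) : nat :=
  i %/ D.*2 * (offset M D).*2 +
  (if i %% D.*2 <= D then offset M (i %% D.*2)
   else (offset M D).*2 - offset M (D.*2 - i %% D.*2)).

Lemma offset_mono M : {homo offset M : a b / a <= b}.
Proof.
apply: homo_leq => // [a b c|a]; first exact: leq_trans.
by rewrite /= -addnA leq_addr.
Qed.

(** Each of the [M] steps after [a] adds at least [1 + offset M a %/ M], and [M] times that exceeds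
    [offset M a]. *)
Lemma offset_double M a : 0 < M -> (offset M a).*2 <= offset M (a + M).
Proof.
move=> M0.
have H k : offset M a + k * (1 + offset M a %/ M) <= offset M (a + k).
  elim: k => [|k IH]; first by rewrite mul0n !addn0.
  rewrite addnS /= mulSn.
  have := leq_div2r M (leq_trans (leq_addr _ _) IH); lia.
have := H M; have := divn_eq (offset M a) M; have := ltn_pmod (offset M a) M0; nia.
Qed.

(** The first [M] steps climb at least [M], each later run of [M] doubles. Hence logarithmically
    many runs suffice for a tall block. *)
Lemma offset_expn M K : 0 < M -> M * 2 ^ K <= offset M (M * K.+1).
Proof.
move=> M0; elim: K => [|K IH].
  rewrite !muln1; have H k : k <= offset M k by elim: k => //= k; move: (_ %/ _); lia.
  exact: H.
rewrite mulnS addnC; apply: leq_trans (offset_double _ M0).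
rewrite expnS; lia.
Qed.

Lemma height_up M D j a : 0 < D -> a <= D ->
  height M D (j * D.*2 + a) = j * (offset M D).*2 + offset M a.
Proof.
move=> D0 aD; have aD2 : a < D.*2 by lia.
by rewrite /height divnMDl ?modnMDl ?divn_small ?modn_small ?addn0 ?aD //; lia.
Qed.

Lemma height_down M D j a : 0 < D -> a <= D ->
  height M D (j.+1 * D.*2 - a) = j.+1 * (offset M D).*2 - offset M a.
Proof.
move=> D0; case: a => [|a] aD.
  by rewrite !subn0 -{1}[(_ * D.*2)]addn0 height_up //= addn0.
have -> : j.+1 * D.*2 - a.+1 = j * D.*2 + (D.*2 - a.+1) by lia.
have aD2 : D.*2 - a.+1 < D.*2 by lia.
have := @offset_mono M _ _ aD.
rewrite /height divnMDl ?modnMDl ?divn_small ?modn_small ?addn0 //; last by lia.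
have -> : D.*2 - (D.*2 - a.+1) = a.+1 by lia.
(* Only the middle of the block, [a.+1 = D], falls in the first branch of [height]; both branches
   agree there. *)
case: ifP => H; last by lia.
have -> : D.*2 - a.+1 = D by lia.
have -> : a.+1 = D by lia.
lia.
Qed.

Lemma height_block M D j : 0 < D -> height M D (j * D.*2) = j * (offset M D).*2.
Proof. by move=> D0; rewrite -[j * D.*2]addn0 height_up // addn0. Qed.

(** Classifies the gap from [i] to [i.+1]: growing half, or mirrored half, where its ends are [a.+1]
    and [a] steps below the next cut. *)
Variant block_spec (D i : nat) : Prop :=
| BlockUp j a of a < D & i = j * D.*2 + a
| BlockDown j a of a < D & i = j.+1 * D.*2 - a.+1.

Lemma blockP D i : 0 < D -> block_spec D i.
Proof.
move=> D0; have D2 : 0 < D.*2 by lia.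
have := ltn_pmod i D2; have := divn_eq i D.*2.
move: (i %/ _) (i %% _) => j a E a2.
have [aD|Da] := ltnP a D; first exact: (@BlockUp D i j a).
apply: (@BlockDown D i j (D.*2 - a.+1)); lia.
Qed.

Lemma height_lt M D i : 0 < D -> height M D i < height M D i.+1.
Proof.
move=> D0; have [j a aD ->|j a aD ->] := blockP i D0.
  by rewrite -addnS !height_up // ?(ltnW aD) //=; move: (_ %/ _); lia.
have -> : (j.+1 * D.*2 - a.+1).+1 = j.+1 * D.*2 - a by lia.
rewrite !height_down // ?(ltnW aD) //.
have := @offset_mono M _ _ aD; rewrite /=; move: (_ %/ M); lia.
Qed.

Lemma height_mono M D : 0 < D -> {mono height M D : i j / i <= j}.
Proof.
move=> D0; apply: leq_mono.
by apply: homo_ltn => [a b c|i]; [apply: ltn_trans|apply: height_lt].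
Qed.

(** A gap is 1 + floor(h / M), with h the distance from its nearer end to the nearest cut. If it
    exceeds 4, then M * gap <= 4 * h, and every cut is at least h away from point [i]. *)
Lemma gap_bound M D i j : 0 < M -> 0 < D ->
  let gap := height M D i.+1 - height M D i in
  gap <= 4 \/
  (if j * D.*2 <= i then M * gap + 4 * height M D (j * D.*2) <= 4 * height M D i
   else M * gap + 4 * height M D i <= 4 * height M D (j * D.*2)).
Proof.
move=> M0 D0 /=; rewrite height_block //.
have [k a aD ->|k a aD ->] := blockP i D0.
  rewrite -addnS !height_up // ?(ltnW aD) //=.
  have := @offset_mono M _ _ (ltnW aD).
  have := divn_eq (offset M a) M; have := ltn_pmod (offset M a) M0.
  move: (offset M a) (offset M D) => h T.
  move: (h %/ M) (h %% M) => d s sM hE hT.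
  have -> : k * T.*2 + (h + 1 + d) - (k * T.*2 + h) = d.+1 by lia.
  have [|d4] := leqP d.+1 4; [by left|right].
  case: ifP => jk.
    have jk' : j <= k by nia.
    have : j * T.*2 <= k * T.*2 by rewrite leq_mul2r jk' orbT.
    nia.
  have jk' : k.+1 <= j by nia.
  have : k.+1 * T.*2 <= j * T.*2 by rewrite leq_mul2r jk' orbT.
  nia.
have -> : (k.+1 * D.*2 - a.+1).+1 = k.+1 * D.*2 - a by lia.
rewrite !height_down // ?(ltnW aD) //=.
have := @offset_mono M _ _ aD => /=.
have := divn_eq (offset M a) M; have := ltn_pmod (offset M a) M0.
move: (offset M a) (offset M D) => h T.
move: (h %/ M) (h %% M) => d s sM hE hT.
have -> : k.+1 * T.*2 - h - (k.+1 * T.*2 - (h + 1 + d)) = d.+1 by lia.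
have [|d4] := leqP d.+1 4; [by left|right].
case: ifP => jk.
  have jk' : j <= k by nia.
  have : j * T.*2 <= k * T.*2 by rewrite leq_mul2r jk' orbT.
  nia.
have jk' : k.+1 <= j by nia.
have : k.+1 * T.*2 <= j * T.*2 by rewrite leq_mul2r jk' orbT.
nia.
Qed.

Local Open Scope ring_scope.

(** * Counting independent cuts over F_2 *)

(* Over F_2, the functionals phi j (j in A) together with the coboundaries of
   the vertex functions vanishing at v0 are independent in the space of edge
   functions; phrased with cardinals of power sets to avoid linear algebra. *)
Lemma cut_count (n m : nat) (E : {set 'I_n * 'I_n})
    (phi : 'I_m -> 'I_n -> 'I_n -> bool) (A : {set 'I_m}) (v0 : 'I_n) :
  (forall (c : 'I_m -> bool) (g : 'I_n -> bool),
     (forall j, j \notin A -> c j = false) -> g v0 = false ->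
     (forall x y, (x, y) \in E ->
        \big[addb/false]_j (c j && phi j x y) = g x (+) g y) ->
     (forall j, c j = false) /\ (forall x, g x = false)) ->
  (#|A| + n.-1 <= #|E|)%N.
Proof.
move=> ker.
pose D := finset.setX (powerset A) (powerset [set~ v0]).
pose F (cf : {set 'I_m} * {set 'I_n}) := [set e in E |
  \big[addb/false]_j ((j \in cf.1) && phi j e.1 e.2)
    (+) ((e.1 \in cf.2) (+) (e.2 \in cf.2))].
have F_inj : {in D &, injective F}.
  move=> [c f] [c' f']; rewrite !inE /=.
  move=> /andP[cA fS] /andP[c'A f'S] /finset.setP FF.
  have fv : v0 \notin f.
    by apply/negP => /(fintype.subsetP fS); rewrite !inE eqxx.
  have f'v : v0 \notin f'.
    by apply/negP => /(fintype.subsetP f'S); rewrite !inE eqxx.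
  (* Linearity: two pairs with the same image differ by an element of the kernel. *)
  have [] := ker (fun j => (j \in c) (+) (j \in c'))
                 (fun x => (x \in f) (+) (x \in f')).
  - move=> j jA; rewrite (contraNF (fintype.subsetP cA j)) //.
    by rewrite (contraNF (fintype.subsetP c'A j)).
  - by rewrite (negPf fv) (negPf f'v).
  - move=> x y xyE; under eq_bigr do rewrite /= andb_addl.
    rewrite big_split /=; have := FF (x, y); rewrite !inE /= xyE /=.
    by case: (\big[_/_]_j _); case: (\big[_/_]_j _); case: (x \in f);
       case: (y \in f); case: (x \in f'); case: (y \in f').
  move=> cc ff; congr pair; apply/finset.setP => z.
    by move: (cc z); case: (z \in c); case: (z \in c').
  by move: (ff z); case: (z \in f); case: (z \in f').
have := card_in_imset F_inj.
rewrite /D cardsX !card_powerset cardsC1 card_ord -expnD => cardF.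
rewrite -(leq_exp2l _ _ (isT : (1 < 2)%N)) -cardF -card_powerset.
apply/fintype.subset_leq_card/fintype.subsetP => e /imsetP[cf _ ->].
by rewrite finset.powersetE; apply/fintype.subsetP => z; rewrite inE => /andP[].
Qed.

(** * Parity of cut crossings along walks *)

Lemma path_const (T A : Type) (e : rel T) (P : pred T) (f : T -> A) u p :
  (forall x y, P x -> P y -> e x y -> f x = f y) ->
  path e u p -> all P (u :: p) -> f (last u p) = f u.
Proof.
move=> fE; elim: p u => //= v p IH u /andP[euv pp] /and3P[Pu Pv Pp].
by rewrite IH //= ?Pv // (fE u v).
Qed.

Fixpoint path_parity {T : Type} (c : T -> T -> bool) (u : T) (p : seq T) :=
  if p is v :: q then c u v (+) path_parity c v q else false.

Lemma path_parityE (T : Type) (e : rel T) (P : pred T) (g : T -> bool)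
    (c : T -> T -> bool) b u p :
  (forall x y, P x -> P y -> e x y -> g x (+) g y = b && c x y) ->
  path e u p -> all P (u :: p) ->
  g u (+) g (last u p) = b && path_parity c u p.
Proof.
move=> gE; elim: p u => [u|v p IH u] /=; first by rewrite addbb andbF.
move=> /andP[euv pp] /and3P[Pu Pv Pp].
rewrite andb_addr -(gE u v) // -IH //= ?Pv //.
by case: (g u); case: (g v); case: (g (last _ _)).
Qed.

(* Vertices 2i and 2i+1 are the left and right points at the i-th height. *)
Definition above (B n j : nat) (x : 'I_n) := (j * B <= x./2)%N.

(** Restricted to the left line on purpose: counting every edge that crosses the cut would give the
    coboundary of [above B j]. *)
Definition left_cut (B n j : nat) (x y : 'I_n) :=
  [&& ~~ odd x, ~~ odd y & above B j x (+) above B j y].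

Lemma left_cutC B n j (x y : 'I_n) : left_cut B j x y = left_cut B j y x.
Proof. by rewrite /left_cut addbC andbCA. Qed.

Lemma big_addb_le_step m (c : 'I_m -> bool) (i j : 'I_m) : j = i.+1 :> nat ->
  \big[addb/false]_(l < m) (c l && (l <= j)%N) =
  \big[addb/false]_(l < m) (c l && (l <= i)%N) (+) c j.
Proof.
move=> ji; rewrite [in LHS](bigD1 j) //= [in RHS](bigD1 j) //= leqnn andbT.
have -> : (j <= i)%N = false by lia.
rewrite andbF /= addbC; congr (_ (+) _); apply: eq_bigr => l.
by rewrite -val_eqE /= => lj; congr (_ && _); lia.
Qed.

(* With U the number, mod 2, of cuts in c below a vertex, g + U is constant on
   the left line and g on the right line, so the rung at cut j gives
   gam + #{i <= j | c i} = c j * b mod 2. The hypothesis that the parity of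
   every rung of c is the same b is what forces c = 0: with mixed parities
   two consecutive rungs may share their crossing edge. *)
Lemma kernel_trivial (n m B : nat) (E : {set 'I_n * 'I_n}) (l r : 'I_m -> 'I_n)
    (q : 'I_m -> seq 'I_n) (b : bool) (c : 'I_m -> bool) (g : 'I_n -> bool)
    (v0 : 'I_n) :
  (0 < B)%N -> (forall j : 'I_m, l j = (j * B).*2 :> nat) ->
  (forall j : 'I_m, r j = (j * B).*2.+1 :> nat) -> v0 = 0%N :> nat ->
  (forall x y : 'I_n, y = x.+2 :> nat -> exists p,
     [/\ path (adj E) x p, last x p = y &
       all (fun v : 'I_n => odd v == odd x) p \/
       forall j : 'I_m, all (fun v => above B j v == above B j x) p]) ->
  (forall j, [/\ path (adj E) (l j) (q j), last (l j) (q j) = r j &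
     forall i, i != j -> all (fun v => above B i v == above B i (l j)) (q j)]) ->
  (forall j, c j -> (0 < j < m.-1)%N &&
     (path_parity (left_cut B j) (l j) (q j) == b)) ->
  g v0 = false ->
  (forall x y, (x, y) \in E ->
        \big[addb/false]_(j < m) (c j && left_cut B j x y) = g x (+) g y) ->
  (0 < m)%N ->
  (forall j, c j = false) /\ (forall x, g x = false).
Proof.
move=> B0 lE rE v00 chain rung cP gv0 gE m0.
pose U (x : 'I_n) := \big[addb/false]_(j < m) (c j && above B j x).
have gadj x y : adj E x y ->
    \big[addb/false]_(j < m) (c j && left_cut B j x y) = g x (+) g y.
  move=> /orP[|/gE]; first exact: gE.
  by rewrite addbC => <-; apply: eq_bigr => j _; rewrite left_cutC.
have stepL (x y : 'I_n) : y = x.+2 :> nat -> ~~ odd x ->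
    g y (+) U y = g x (+) U x.
  move=> yx ox; have [p [pp <-]] := chain x y yx.
  case=> [po|pa].
    (* On the left line [left_cut] is the coboundary of [above], so [g] and [U] jump together. *)
    apply: (@path_const _ _ (adj E) (fun v : 'I_n => odd v == odd x)
      (fun v => g v (+) U v)) => //=.
      move=> u v /eqP ou /eqP ov uv; have := gadj _ _ uv.
      rewrite /left_cut ou ov ox /= /U.
      under eq_bigr do rewrite andb_addr.
      rewrite big_split /=.
      by case: (g u); case: (g v); case: (\big[_/_]_j _); case: (\big[_/_]_j _).
    by rewrite eqxx.
  (* A walk that meets no cut keeps [U] constant, and [g] too. *)
  apply: (@path_const _ _ (adj E)
      (fun v : 'I_n => [forall j : 'I_m, above B j v == above B j x])
      (fun v => g v (+) U v)) => //=.
    move=> u v /forallP au /forallP av uv.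
    have -> : U u = U v.
      by apply: eq_bigr => j _; rewrite (eqP (au j)) (eqP (av j)).
    congr (_ (+) _); have := gadj _ _ uv.
    rewrite big1; first by case: (g u); case: (g v).
    by move=> j _; rewrite /left_cut (eqP (au j)) (eqP (av j)) addbb !andbF.
  apply/andP; split; first by apply/forallP.
  by apply/allP => v vp; apply/forallP => j; exact: (allP (pa j) v vp).
have stepR (x y : 'I_n) : y = x.+2 :> nat -> odd x -> g y = g x.
  move=> yx ox; have [p [pp <-]] := chain x y yx.
  case=> [po|pa].
    apply: (@path_const _ _ (adj E) (fun v : 'I_n => odd v == odd x) g) => //=.
      move=> u v /eqP ou /eqP ov uv; have := gadj _ _ uv.
      rewrite big1; first by case: (g u); case: (g v).
      by move=> j _; rewrite /left_cut ou ox andbF.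
    by rewrite eqxx.
  apply: (@path_const _ _ (adj E)
      (fun v : 'I_n => [forall j : 'I_m, above B j v == above B j x]) g) => //=.
    move=> u v /forallP au /forallP av uv.
    have := gadj _ _ uv.
    rewrite big1; first by case: (g u); case: (g v).
    by move=> j _; rewrite /left_cut (eqP (au j)) (eqP (av j)) addbb !andbF.
  apply/andP; split; first by apply/forallP.
  by apply/allP => v vp; apply/forallP => j; exact: (allP (pa j) v vp).
have n1 : (1 < n)%N.
  have := ltn_ord (r (Ordinal m0)); rewrite rE /=; lia.
pose v1 := Ordinal n1.
have constL : forall x : 'I_n, ~~ odd x -> g x (+) U x = g v0 (+) U v0.
  move=> [x xn]; elim/ltn_ind: x xn => -[|[|x]] IH xn //= ox.
    by congr (g _ (+) U _); apply: val_inj => /=; rewrite v00.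
  have xn' : (x < n)%N by lia.
  by rewrite -(IH x _ xn') //=; [apply: stepL => //=|]; move: ox; rewrite negbK.
have constR : forall x : 'I_n, odd x -> g x = g v1.
  move=> [x xn]; elim/ltn_ind: x xn => -[|[|x]] IH xn //= ox.
    by congr (g _); apply: val_inj.
  have xn' : (x < n)%N by lia.
  by rewrite -(IH x _ xn') //=; [apply: stepR => //=|]; move: ox; rewrite negbK.
have rungE j : g (l j) (+) g (r j) = c j && path_parity (left_cut B j) (l j) (q j).
  have [pq <- aq] := rung j.
  apply: (@path_parityE _ (adj E) (fun v : 'I_n =>
    [forall i : 'I_m, (i != j) ==> (above B i v == above B i (l j))])) => //=.
    move=> u v /forallP au /forallP av uv; rewrite -(gadj _ _ uv).
    rewrite (bigD1 j) //= big1 ?addbF // => i ij.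
    move: (au i) (av i); rewrite ij /= => /eqP ai /eqP ai'.
    by rewrite /left_cut ai ai' addbb !andbF.
  apply/andP; split; first by apply/forallP => i; rewrite eqxx implybT.
  apply/allP => v vp; apply/forallP => i; apply/implyP => ij.
  exact: (allP (aq i ij) v vp).
pose V (j : 'I_m) := \big[addb/false]_(i < m) (c i && (i <= j)%N).
have UV j : U (l j) = V j.
  apply: eq_bigr => i _; rewrite /above lE doubleK leq_pmul2r //.
pose i0 := Ordinal m0.
have ci0 : c i0 = false by apply/negP => /cP.
pose gam := g v1 (+) U v0.
have VE j : V j = gam (+) (c j && b).
  have := rungE j; have := constL (l j); have := constR (r j).
  rewrite lE rE /= !odd_double /= => -> // /(_ isT); rewrite gv0 UV.
  have : (c j && path_parity (left_cut B j) (l j) (q j)) = c j && b.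
    by case cj: (c j) => //=; have /andP[_ /eqP] := cP _ cj.
  move=> ->; rewrite /gam.
  by case: (g (l j)); case: (g v1); case: (U v0); case: (V j); case: (c j && b).
(* Read off at the lowest cut, which is not in [c]. *)
have gam0 : gam = false.
  have := VE i0; rewrite ci0 /= addbF => <-.
  rewrite /V big1 // => i _; case: (posnP i) => i0'; last first.
    by rewrite leqNgt i0' andbF.
  by rewrite (_ : i = i0) ?ci0 //; apply: val_inj.
have c0 j : c j = false.
  case jm: (j < m.-1)%N; last first.
    by apply/negP => /cP; rewrite jm andbF.
  have jm' : (j.+1 < m)%N by lia.
  have := VE (Ordinal jm'); rewrite gam0 /= /V (@big_addb_le_step _ _ j) //.
  rewrite -/(V j) VE gam0 /=.
  (* If [b] holds, V j = c j, and the step to j + 1 cancels c (j + 1), leaving c j = 0. Otherwise V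
     vanishes, and c j = V j + V (j - 1) = 0. *)
  case bE : b; first by rewrite !andbT; case: (c j); case: (c (Ordinal _)).
  rewrite !andbF /= => _.
  case: (posnP j) => j0.
    by rewrite (_ : j = i0) //; apply: val_inj.
  have jm2 : (j.-1 < m)%N by lia.
  have := VE j; rewrite /V (@big_addb_le_step _ _ (Ordinal jm2)) /=; last by lia.
  by rewrite -/(V (Ordinal jm2)) VE gam0 bE !andbF.
split=> // x.
have U0 y : U y = false by rewrite /U big1 // => i _; rewrite c0.
have gv1 : g v1 = false by move: gam0; rewrite /gam U0 addbF.
case ox: (odd x); first by rewrite constR.
by have := constL x; rewrite ox !U0 !addbF gv0 => ->.
Qed.

(** * The ladder as a point set, and lengths of walks *)

Definition ladder (M D n : nat) (x : 'I_n) : Defs.point :=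
  (if odd x then M%:R else 0, (height M D x./2)%:R).

Lemma dist_fst (p q : Defs.point) : `|p.1 - q.1| <= dist p q.
Proof. by rewrite /dist -sqrtr_sqr ler_wsqrtr // lerDl sqr_ge0. Qed.

Lemma dist_snd (p q : Defs.point) : `|p.2 - q.2| <= dist p q.
Proof. by rewrite /dist -sqrtr_sqr ler_wsqrtr // lerDr sqr_ge0. Qed.

Lemma dist_vert (p q : Defs.point) : p.1 = q.1 -> dist p q = `|p.2 - q.2|.
Proof. by move=> pq; rewrite /dist pq subrr expr0n add0r sqrtr_sqr. Qed.

Lemma dist_horiz (p q : Defs.point) : p.2 = q.2 -> dist p q = `|p.1 - q.1|.
Proof. by move=> pq; rewrite /dist pq subrr expr0n addr0 sqrtr_sqr. Qed.

Lemma walk_len_cons n (S : 'I_n -> Defs.point) u v p :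
  walk_len S u (v :: p) = dist (S u) (S v) + walk_len S v p.
Proof. by rewrite /walk_len /= big_cons. Qed.

Lemma walk_len_ge0 n (S : 'I_n -> Defs.point) u p : 0 <= walk_len S u p.
Proof.
elim: p u => [|v p IH] u; first by rewrite /walk_len /= big_nil.
by rewrite walk_len_cons addr_ge0 // sqrtr_ge0.
Qed.

(** Triangle inequality along the walk. Applied to the two coordinates, it confines a short walk to
    one line or to a band of heights. *)
Lemma walk_len_lip n (S : 'I_n -> Defs.point) (F : Defs.point -> R) u p v :
  (forall x y, `|F x - F y| <= dist x y) -> v \in u :: p ->
  `|F (S v) - F (S u)| <= walk_len S u p.
Proof.
move=> FL; elim: p u => [u|w p IH u].
  by rewrite inE => /eqP ->; rewrite subrr normr0 /walk_len /= big_nil.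
rewrite walk_len_cons inE => /orP[/eqP ->|vp].
  by rewrite subrr normr0 addr_ge0 ?sqrtr_ge0 ?walk_len_ge0.
have := IH w vp; have := FL (S u) (S w); rewrite distrC => h1 h2.
by have := ler_distD (F (S w)) (F (S v)) (F (S u)); lra.
Qed.

Lemma dist_gt0 (p q : Defs.point) : p != q -> 0 < dist p q.
Proof.
move=> pq; rewrite lt_neqAle sqrtr_ge0 andbT eq_sym; apply: contra_neq pq => d0.
have := dist_fst p q; have := dist_snd p q; rewrite d0 !normr_le0 !subr_eq0.
by case: p q {d0} => [? ?] [? ?] /= /eqP -> /eqP ->.
Qed.

(** The strict bound on the infimum [dG] yields an actual walk, without asking that a minimum be
    attained. *)
Lemma dilation_walk n (S : 'I_n -> Defs.point) E (t : R) u v :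
  injective S -> (dilation S E < t%:E)%E -> u != v ->
  exists p, [/\ path (adj E) u p, last u p = v &
                walk_len S u p < t * dist (S u) (S v)].
Proof.
move=> Sinj dt uv.
have d0 : 0 < dist (S u) (S v) by rewrite dist_gt0 // (inj_eq Sinj).
have : (dG S E u v * ((dist (S u) (S v))^-1)%:E < t%:E)%E.
  apply: le_lt_trans dt; apply: ereal_sup_ubound.
  by exists (u, v) => //=; apply/eqP.
rewrite lte_pdivrMr // -EFinM => /ereal_inf_lt[_ [p [pp lp] <-]].
by rewrite lte_fin => ?; exists p.
Qed.

Lemma ladder_inj M D n : (0 < M)%N -> (0 < D)%N -> injective (@ladder M D n).
Proof.
move=> M0 D0 x y [xy].
move=> /eqP; rewrite eqr_nat => /eqP /(inc_inj (height_mono M D0)) h.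
apply: val_inj => /=; rewrite -(odd_double_half x) -(odd_double_half y) h.
congr (_ + _)%N; move: xy.
have M1 : (M%:R == 0 :> R) = false by rewrite pnatr_eq0; lia.
case: (odd x); case: (odd y) => // /eqP; first by rewrite M1.
by rewrite eq_sym M1.
Qed.

(** The hull lies in the strip between the two lines, so a small outward horizontal shift of any
    point leaves it. *)
Lemma ladder_convex M D n : convex_position (@ladder M D n).
Proof.
move=> i [e [e0 H]].
have dd (p : Defs.point) a : dist (p.1 + a, p.2) p = `|a|.
  by rewrite dist_horiz //= addrC addKr.
have fst_ge0 w : (forall j, 0 <= w j) ->
    0 <= \sum_j w j * (@ladder M D n j).1.
  move=> w0; apply: sumr_ge0 => j _; apply: mulr_ge0 => //=.
  by case: ifP.
have fst_le w : (forall j, 0 <= w j) -> \sum_j w j = 1 ->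
    \sum_j w j * (@ladder M D n j).1 <= M%:R.
  move=> w0 w1; apply: (@le_trans _ _ (\sum_j w j * M%:R)); last first.
    by rewrite -mulr_suml w1 mul1r.
  by apply: ler_sum => j _; apply: ler_wpM2l => //=; case: ifP.
case oi: (odd i).
  have [|w [w0 [w1 [q1 _]]]] := H ((ladder M D i).1 + e / 2, (ladder M D i).2).
    by rewrite dd ger0_norm; lra.
  have := fst_le w w0 w1; rewrite -q1 /= oi; lra.
have [|w [w0 [w1 [q1 _]]]] := H ((ladder M D i).1 + - (e / 2), (ladder M D i).2).
  by rewrite dd normrN ger0_norm; lra.
have := fst_ge0 w w0; rewrite -q1 /= oi; lra.
Qed.

(** * Walks forced by small dilation *)

Lemma ladder_side M D n (x v : 'I_n) j (s : R) : (0 < D)%N ->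
  `|(ladder M D v).2 - (ladder M D x).2| < s ->
  s <= `|(ladder M D x).2 - (height M D (j * D.*2))%:R| ->
  above D.*2 j v = above D.*2 j x.
Proof.
move=> D0; rewrite /above -[in LHS](height_mono M D0).
rewrite -[in RHS](height_mono M D0) -!(ler_nat R) /=.
move: (_%:R) (_%:R) (_%:R) => z b a h1 h2.
have {h1 h2} h := lt_le_trans h1 h2.
apply/idP/idP => zz; rewrite leNgt; apply/negP => zz'; move: h.
  by rewrite (ler0_norm (_ : b - z <= 0)) ?ger0_norm; lra.
by rewrite (ger0_norm (_ : 0 <= b - z)) ?ler0_norm; lra.
Qed.

Lemma ladder_parity M D n (x v : 'I_n) (s : R) :
  `|(ladder M D v).1 - (ladder M D x).1| < s -> s <= M%:R -> odd v = odd x.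
Proof.
move=> /= h1 h2; have := lt_le_trans h1 h2.
by case: (odd x); case: (odd v); rewrite ?subr0 ?sub0r ?normrN ?normr_nat ?ltxx.
Qed.

Lemma half_double_S i : (i.*2.+1)./2 = i.
Proof. by rewrite -addn1 halfD odd_double doubleK addn0. Qed.

(** By [gap_bound]: if the gap is at most 4, the walk is shorter than 4 * t <= M and cannot change
    line; otherwise t * gap <= M * gap / 4 is at most the distance to any cut. *)
Lemma ladder_chain M D n (E : {set 'I_n * 'I_n}) (t : R) (x y : 'I_n) :
  (0 < M)%N -> (0 < D)%N -> 4 * t <= M%:R ->
  (dilation (@ladder M D n) E < t%:E)%E -> y = x.+2 :> nat ->
  exists p, [/\ path (adj E) x p, last x p = y &
    all (fun v : 'I_n => odd v == odd x) p \/
    forall j, all (fun v => above D.*2 j v == above D.*2 j x) p].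
Proof.
move=> M0 D0 tM dt yx.
have xy : x != y by apply/eqP => /(congr1 val) /=; lia.
have [p [pp lp]] := dilation_walk (ladder_inj M0 D0) dt xy.
have yh : y./2 = x./2.+1 by rewrite yx.
have oy : odd y = odd x by rewrite yx /= negbK.
pose gap := (height M D (x./2).+1 - height M D x./2)%N.
have -> : dist (ladder M D x) (ladder M D y) = gap%:R.
  rewrite dist_vert /= ?oy // yh distrC -natrB ?normr_nat //.
  exact/ltnW/height_lt.
move=> wp; exists p; split=> //.
have M0' : (0 : R) <= M%:R by [].
have g0 : (0 : R) <= gap%:R by [].
have tg : 4 * (t * gap%:R) <= M%:R * gap%:R by rewrite mulrA ler_wpM2r.
have [g4|g4] := leqP gap 4; [left|right=> j]; apply/allP => v vp; apply/eqP.
  apply: (@ladder_parity M D _ _ _ M%:R) => //.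
  apply: le_lt_trans (@walk_len_lip n _ fst _ p v dist_fst _) _.
    by rewrite inE vp orbT.
  apply: lt_le_trans wp _.
  have g4' : (gap%:R : R) <= 4 by rewrite ler_nat.
  have : M%:R * gap%:R <= M%:R * 4 :> R by rewrite ler_wpM2l.
  lra.
apply: (@ladder_side M D _ _ _ _ (t * gap%:R)) => //.
  apply: le_lt_trans (@walk_len_lip n _ snd _ p v dist_snd _) wp.
  by rewrite inE vp orbT.
have mg0 : 0 <= M%:R * gap%:R :> R by rewrite mulr_ge0.
have [|] := @gap_bound M D x./2 j M0 D0; first by rewrite -/gap leqNgt g4.
rewrite -/gap /=; clearbody gap => {wp g4 g0}.
case: ifP => jx; rewrite -(ler_nat R) natrD !natrM => h.
  by rewrite ger0_norm; lra.
by rewrite ler0_norm; lra.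
Qed.

(** The walk is shorter than t * M <= M^2 / 4, which is at most the spacing of the cuts. *)
Lemma ladder_rung M D n (E : {set 'I_n * 'I_n}) (t : R) j (l r : 'I_n) :
  (0 < M)%N -> (0 < D)%N -> 4 * t <= M%:R -> (M * M <= 4 * (offset M D).*2)%N ->
  (dilation (@ladder M D n) E < t%:E)%E ->
  l = (j * D.*2).*2 :> nat -> r = (j * D.*2).*2.+1 :> nat ->
  exists p, [/\ path (adj E) l p, last l p = r &
    forall i, i != j -> all (fun v => above D.*2 i v == above D.*2 i l) p].
Proof.
move=> M0 D0 tM MT dt lE rE.
have lr : l != r by apply/eqP => /(congr1 val) /=; lia.
have [p [pp lp]] := dilation_walk (ladder_inj M0 D0) dt lr.
have lh : l./2 = (j * D.*2)%N by rewrite lE doubleK.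
have rh : r./2 = (j * D.*2)%N by rewrite rE half_double_S.
have -> : dist (ladder M D l) (ladder M D r) = M%:R.
  rewrite dist_horiz /= ?lh ?rh // lE rE /= odd_double /=.
  by rewrite sub0r normrN normr_nat.
move=> wp; exists p; split=> // i ij; apply/allP => v vp; apply/eqP.
apply: (@ladder_side M D _ _ _ _ (t * M%:R)) => //.
  apply: le_lt_trans (@walk_len_lip n _ snd _ p v dist_snd _) wp.
  by rewrite inE vp orbT.
rewrite /= lh !height_block //.
move: MT; rewrite -(ler_nat R) !natrM => MT.
apply: (@le_trans _ _ (offset M D).*2%:R).
  have M0' : (0 : R) <= M%:R by [].
  nra.
have T0 : (0 : R) <= (offset M D).*2%:R by [].
rewrite -mulrBl normrM (ger0_norm T0) ler_peMl //.
have [ij'|ji|] := ltngtP i j; last by move/eqP; rewrite (negPf ij).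
  by rewrite -natrB ?(ltnW ij') // normr_nat ler1n subn_gt0.
by rewrite distrC -natrB ?(ltnW ji) // normr_nat ler1n subn_gt0.
Qed.

(** * Lower bounds on the dilation *)

Lemma ladder_dilation M D n k (E : {set 'I_n * 'I_n}) (t : R) :
  (0 < M)%N -> (0 < D)%N -> 4 * t <= M%:R -> (M * M <= 4 * (offset M D).*2)%N ->
  (((k.*2.+3) * D.*2).*2.+1 < n)%N -> #|E| = (n - 1 + k)%N ->
  (t%:E <= dilation (@ladder M D n) E)%E.
Proof.
move=> M0 D0 tM MT nk cE; rewrite leNgt; apply/negP => dt.
(* Without the two extreme cuts, 2k + 2 remain, so one of the two parity classes has at least k + 1,
   giving at least k + n > #|E| independent functionals. *)
pose m := k.*2.+4.
have l_lt (j : 'I_m) : ((j * D.*2).*2.+1 < n)%N.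
  apply: leq_ltn_trans nk; rewrite ltnS leq_double leq_mul2r; apply/orP; right.
  by have := ltn_ord j.
pose r (j : 'I_m) := Ordinal (l_lt j).
pose l (j : 'I_m) := Ordinal (ltnW (l_lt j)).
have n0 : (0 < n)%N by lia.
have [q qP] := boolp.choice (fun j : 'I_m =>
  @ladder_rung M D n E t j (l j) (r j) M0 D0 tM MT dt erefl erefl).
pose a (j : 'I_m) := path_parity (left_cut D.*2 j) (l j) (q j).
pose A b := [set j : 'I_m | (0 < j < m.-1)%N & a j == b].
have bound b : (#|A b| + n.-1 <= #|E|)%N.
  apply: (@cut_count n m E (fun j => left_cut D.*2 j) _ (Ordinal n0))
    => c g cA g0 gE.
  apply: (@kernel_trivial n m D.*2 E l r q b c g (Ordinal n0)) => //.
  - by rewrite double_gt0.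
  - move=> x y yx; have [p [pp lp H]] := ladder_chain M0 D0 tM dt yx.
    by exists p; split=> //; case: H => H; [left|right=> j; apply: H].
  - move=> j; have [? ? H] := qP j; split=> // i ij; exact: H.
  - move=> j cj; have : j \in A b by apply: contraLR cj => /cA ->.
    by rewrite inE.
have : (#|A true| + #|A false| = m - 2)%N.
  rewrite -cardsUI (_ : A true :&: A false = finset.set0) ?cards0 ?addn0; last first.
    apply/finset.setP => j; rewrite !inE.
    by case: (a j); rewrite ?andbF.
  rewrite (_ : A true :|: A false = [set~ ord0] :\ ord_max); last first.
    apply/finset.setP => j; rewrite !inE -andb_orr.
    have -> : (a j == true) || (a j == false) by case: (a j).
    by have := ltn_ord j; rewrite andbT -!val_eqE /= /m; lia.
  have := cardsD1 ord_max [set~ (ord0 : 'I_m)].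
  by rewrite cardsC1 card_ord !inE /=; move: #|_| => s; rewrite /m; lia.
by have := bound true; have := bound false; rewrite cE /m; move: #|A true| #|A false|; lia.
Qed.

(** The bottom rung is horizontal, so no walk between its ends is shorter than it. This settles
    targets [t] up to 1. *)
Lemma dilation_ge1 M D n (E : {set 'I_n * 'I_n}) :
  (0 < M)%N -> (0 < D)%N -> (1 < n)%N -> (1 <= dilation (@ladder M D n) E)%E.
Proof.
move=> M0 D0 n1; rewrite leNgt; apply/negP => dt.
pose u := Ordinal (ltnW n1); pose v := Ordinal n1.
have [p [_ lp]] := dilation_walk (ladder_inj M0 D0) dt (isT : u != v).
rewrite mul1r ltNge => /negP; apply.
rewrite dist_horiz // distrC.
apply: (@walk_len_lip n _ fst _ p v dist_fst _).
by rewrite -lp mem_last.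
Qed.

Lemma Delta_le_delta_C M D n k (t : R) : (0 < M)%N -> (0 < D)%N ->
  (forall E : {set 'I_n * 'I_n}, #|E| = (n - 1 + k)%N ->
     (t%:E <= dilation (@ladder M D n) E)%E) ->
  (t%:E <= delta_C n k)%E.
Proof.
move=> M0 D0 H; apply: (@le_trans _ _ (Delta (@ladder M D n) k)); last first.
  apply: ereal_sup_ubound; exists (ladder M D (n:=n)) => //.
  by split; [apply: ladder_inj|apply: ladder_convex].
by apply: le_ereal_inf_tmp => _ [E [_ cE] <-]; apply: H.
Qed.

(** * Choice of parameters *)

Lemma trunc_log2_le_ln n : (1 < n)%N ->
  (trunc_log 2 n)%:R + 2 <= 6 * ln (n%:R : R).
Proof.
move=> n1.
have ln2 : 1 / 2 <= ln (2 : R).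
  (* ln (1 + x) <= x at x = -1/2 gives ln 2 >= 1/2. *)
  have := @le_ln1Dx R (- (1 / 2)); rewrite (_ : 1 + - (1 / 2) = 2^-1); last by lra.
  by rewrite lnV ?posrE //; lra.
have n0 : (0 < n)%N by lia.
have := @trunc_logP 2 n isT n0; rewrite -(ler_nat R) natrX => h.
have : ln ((2 : R) ^+ trunc_log 2 n) <= ln n%:R.
  by rewrite ler_ln ?posrE ?exprn_gt0 ?ltr0n.
rewrite lnXn // -(mulr_natl (ln 2)).
have l2n : ln (2 : R) <= ln n%:R by rewrite ler_ln ?posrE ?ltr0n // ler_nat.
have : (trunc_log 2 n)%:R * (1 / 2) <= (trunc_log 2 n)%:R * ln (2 : R).
  by rewrite ler_wpM2l.
lra.
Qed.

Theorem theorem3 :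
  exists c : R, 0 < c /\ exists n0 : nat,
    forall n k : nat, (n0 <= n)%N -> (k < n)%N ->
      ((c * n%:R / (k.+1%:R * ln (n%:R : R)))%:E <= delta_C n k)%E.
Proof.
(* The top rung has index at most 4 * 90 * t * (k + 1) * ln n + 1 = 0.36 * n + 1, which is below n
   for n >= 2. *)
exists (1 / 1000); split; first by lra.
exists 2 => n k n2 kn; set t := (X in X%:E).
have k0 : (0 : R) < k.+1%:R by [].
have n0 : (0 : R) < n%:R by rewrite ltr0n; lia.
have lnP := trunc_log2_le_ln n2.
have L0 : 0 < ln n%:R :> R by apply: ln_gt0; rewrite ltr1n.
have kL0 : 0 < k.+1%:R * ln n%:R :> R by apply: mulr_gt0.
have t0 : 0 <= t.
  apply: divr_ge0; last exact: ltW.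
  by apply: mulr_ge0; [lra|exact: ltW].
have tE : 1000 * (t * (k.+1%:R * ln n%:R)) = n%:R.
  by rewrite /t mulfVK ?gt_eqF //; lra.
clearbody t.
have [t1|t1] := leP t 1.
  apply: (@Delta_le_delta_C 1 1) => // E _.
  by apply: le_trans (dilation_ge1 _ _ _ _); rewrite ?lee_fin.
(* The least integer above 4 * t; at most 5 * t since t > 1. *)
pose M := (Num.truncn (4 * t)).+1.
have tM : 4 * t < M%:R by apply: truncnS_gt.
have Mt : M%:R <= 5 * t.
  rewrite /M -natr1; have := truncn_le (4 * t); rewrite mulr_ge0 //; lra.
(* Makes M <= n <= 2 ^ K, so a block of half-length [D] is at least M * M high. *)
pose K := (trunc_log 2 n).+1.
pose D := (M * K.+1)%N.
have D0 : (0 < D)%N by rewrite /D muln_gt0.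
apply: (@Delta_le_delta_C M D) => // E cE.
have kL : (1 : R) <= k.+1%:R by rewrite ler1n.
have L3 : 1 / 3 <= ln n%:R :> R.
  have : 0 <= (trunc_log 2 n)%:R :> R by [].
  lra.
have tn : 5 * t <= n%:R.
  have : 1 * (1 / 3) <= k.+1%:R * ln n%:R :> R by apply: ler_pM.
  move=> /(ler_wpM2l t0); move: tE; move: (t * (_ * ln _)) => z; lra.
apply: (@ladder_dilation M D n k) => //.
- exact: ltW.
- have Mn : (M <= n)%N by rewrite -(ler_nat R); apply: le_trans tn.
  have Mle : (M <= 2 ^ K)%N.
    by apply: leq_trans Mn _; apply/ltnW/trunc_log_ltn.
  have := @offset_expn M K isT; rewrite -/D.
  have : (M * M <= M * 2 ^ K)%N by rewrite leq_mul2l Mle orbT.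
  by move=> h1 h2; rewrite -mul2n mulnA (leq_trans h1) ?(leq_trans h2) ?leq_pmull.
- rewrite -(ltr_nat R) -addn1 -!muln2 /D /K !natrD !natrM.
  have n2' : (2 : R) <= n%:R by rewrite ler_nat.
  have kE : (k * 2).+3%:R <= 3 * k.+1%:R :> R.
    by rewrite -natrM ler_nat; clear; lia.
  have KE : (trunc_log 2 n).+2%:R <= 6 * ln n%:R :> R.
    by rewrite -addn2 natrD.
  have : (k * 2).+3%:R * (M%:R * (trunc_log 2 n).+2%:R) <=
         3 * k.+1%:R * (5 * t * (6 * ln n%:R)).
    by apply: ler_pM => //; apply: ler_pM.
  have -> : 3 * k.+1%:R * (5 * t * (6 * ln n%:R)) =
            90 * (t * (k.+1%:R * ln n%:R)) by ring.
  move: tE; move: (t * (_ * ln _)) (k * 2).+3%:R M%:R (trunc_log 2 n).+2%:R.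
  by move=> z a b c; lra.
Qed.
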